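(* Let $G$ be a finite, simple, connected $3$-$\gamma_{c}$-critical graph with $\delta(G) \geq 2$. If $\kappa(G) \leq \delta(G) - 1$, then $\alpha(G) \leq \kappa(G)$ or $G \in \mathcal{G}_{2}(3,3)$.
   Context: All graphs are finite, simple and connected. A set $D \subseteq V(G)$ is a connected dominating set of $G$ if every vertex of $G$ is in $D$ or adjacent to a vertex of $D$, and $G[D]$ is connected; $\gamma_{c}(G)$ is the minimum size of such a set. For non-adjacent $u,v$, $G+uv$ is $G$ with edge $uv$ added. $G$ is $3$-$\gamma_{c}$-critical if $\gamma_{c}(G)=3$ and $\gamma_{c}(G+uv)<3$ for every pair of non-adjacent vertices $u,v$. $\alpha(G)$ is the independence number, $\delta(G)$ the minimum degree, $\kappa(G)$ the connectivity (minimum size of a vertex set whose removal disconnects $G$). The class $\mathcal{G}_{2}(3,3)$: take integers $j_1, j_2 \geq 3$, pairwise disjoint vertex sets $J_1, J_2$ with $|J_1| = j_1$, $|J_2| = j_2$, two distinct vertices $u_1, u_2 \in J_2$, and three further vertices $w, w_1, v_1$. Form the graph on $J_1 \cup J_2 \cup \{w, w_1, v_1\}$ whose edges are exactly: all edges inside $J_1$, all edges inside $J_2$, $v_1$ joined to every vertex of $J_1$, $w_1$ joined to every vertex of $J_1 \cup (J_2 \setminus \{u_1\}) \cup \{w\}$, and $w$ joined to every vertex of $J_1 \cup (J_2 \setminus \{u_2\}) \cup \{w_1\}$. $\mathcal{G}_{2}(3,3)$ is the class of all graphs (up to isomorphism) obtained this way. *)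

(* Defs.v *)
From mathcomp Require Import all_boot.

Set Implicit Arguments.
Unset Strict Implicit.
Unset Printing Implicit Defensive.

(* A finite simple graph is a symmetric irreflexive relation e on a finType. *)

Section GraphNotions.

Variables (T : finType) (e : rel T).
Implicit Types (D S : {set T}) (x y u v : T).

Definition induced D : rel T := [rel x y | [&& x \in D, y \in D & e x y]].

(* The empty set counts as connected: deleting all vertices is not a cut, and
   the empty set is not dominating unless T is empty. *)
Definition connected_on D : bool :=
  [forall x in D, forall y in D, connect (induced D) x y].

Definition connected_graph : bool := connected_on [set: T].

Definition dominating D : bool :=
  [forall x, (x \in D) || [exists y in D, e x y]].

Definition connected_dominating D : bool := dominating D && connected_on D.

(* In a connected graph the full vertex set is connected dominating, so the
   default value #|T| is harmless. *)
Definition gamma_c : nat :=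
  \big[minn/#|T|]_(D : {set T} | connected_dominating D) #|D|.

Definition add_edge u v : rel T :=
  [rel x y | [|| e x y, (x == u) && (y == v) | (x == v) && (y == u)]].

Definition independent S : bool :=
  [forall x in S, forall y in S, ~~ e x y].

Definition alpha : nat := \max_(S : {set T} | independent S) #|S|.

Definition degree x : nat := #|[set y | e x y]|.

(* Degrees are smaller than #|T|, so the default only matters if T is empty. *)
Definition min_degree : nat := \big[minn/#|T|]_(x : T) degree x.

Definition vertex_cut S : bool := ~~ connected_on (~: S).

(* A vertex cut leaves at least two vertices, so the default is attained only
   by graphs without vertex cuts, i.e. complete graphs. *)
Definition kappa : nat :=
  \big[minn/#|T|.-1]_(S : {set T} | vertex_cut S) #|S|.

End GraphNotions.

Definition gamma_c_critical3 (T : finType) (e : rel T) : Prop :=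
  gamma_c e = 3 /\
  forall u v : T, u != v -> ~~ e u v -> gamma_c (add_edge e u v) < 3.

Section ClassG2.

Variable T : finType.

Definition G2_33_arc (J1 J2 : {set T}) (u1 u2 w w1 v1 : T) : rel T :=
  [rel x y |
    [|| [&& x \in J1, y \in J1 & x != y],
        [&& x \in J2, y \in J2 & x != y],
        (x == v1) && (y \in J1),
        (x == w1) && (y \in J1 :|: (J2 :\ u1) :|: [set w])
      | (x == w) && (y \in J1 :|: (J2 :\ u2) :|: [set w1])]].

Definition G2_33_edge (J1 J2 : {set T}) (u1 u2 w w1 v1 : T) : rel T :=
  [rel x y | G2_33_arc J1 J2 u1 u2 w w1 v1 x y
          || G2_33_arc J1 J2 u1 u2 w w1 v1 y x].

(* Membership up to isomorphism: the vertices of (T, e) themselves can be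
   labelled so that the edges are exactly those of the construction. *)
Definition in_G2_33 (e : rel T) : Prop :=
  exists (J1 J2 : {set T}) (u1 u2 w w1 v1 : T),
    [/\ [/\ 3 <= #|J1|, 3 <= #|J2| & [disjoint J1 & J2]],
        [/\ u1 \in J2, u2 \in J2 & u1 != u2],
        uniq [:: w; w1; v1] /\ [disjoint J1 :|: J2 & [set w; w1; v1]],
        J1 :|: J2 :|: [set w; w1; v1] = [set: T]
      & e =2 G2_33_edge J1 J2 u1 u2 w w1 v1].

End ClassG2.

(* Main.v *)
Require Import Defs.
From mathcomp Require Import all_boot zify.

(** Call a pair of adjacent vertices [u], [z] that dominates everything except
    [v] a [dom_but u z v].  In a 3-gamma_c-critical graph no adjacent pair
    dominates, and two nonadjacent vertices [u], [v] either dominate together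
    or satisfy [dom_but u z v] or [dom_but v z u] for some [z].

    Let [S] be a minimum cut.  As [#|S|] is less than the minimum degree, every
    vertex outside [S] has a neighbour on its own side, so [dom_but u z v] with
    [u] outside [S] forces [z] into [S].  Let [I] be independent with
    [#|S| + 1 >= 3] elements.  No two elements of [I] dominate, so among any two
    elements of [I :\: S] one is the only element of [I] missed by some vertex
    of [S :\: I].  Counting shows that exactly one [a0] in [I :\: S] is not
    missed in this way and that [S :\: I] is matched with the other elements of
    [I :\: S].  If [A] is the side of [a0] and [B] the other one, criticality
    applied to [a0] and [B] puts [I :\: (S :|: [set a0])] inside [B] and joins
    [B :\: I] completely to [S]; the pairs between [A] and [B] then leave only
    the case of a single vertex [a1] of [I] in [B], where [S] has two elements
    and all adjacencies are forced. *)

Set Implicit Arguments.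
Unset Strict Implicit.
Unset Printing Implicit Defensive.

(** * Minima over finite families with a default value *)

Section BigMin.

Variables (I : finType) (n : nat) (P : pred I) (F : I -> nat).

Lemma bigminn_le i : P i -> \big[minn/n]_(j | P j) F j <= F i.
Proof.
move=> Pi; have := mem_index_enum i.
elim: (index_enum I) => // j r IHr; rewrite inE big_cons => /orP[/eqP<-|/IHr le_r].
  by rewrite Pi geq_minl.
by case: ifP => // _; apply: leq_trans le_r; apply: geq_minr.
Qed.

Lemma bigminn_le_idx : \big[minn/n]_(j | P j) F j <= n.
Proof.
elim: (index_enum I) => [|j r IHr]; rewrite ?big_nil // big_cons.
by case: ifP => // _; apply: leq_trans IHr; apply: geq_minr.
Qed.

Lemma bigminn_ltP k :
  \big[minn/n]_(j | P j) F j < k -> n < k \/ exists2 i, P i & F i < k.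
Proof.
elim/big_ind: _ => [|x y IHx IHy|i Pi lt_k]; first by left.
  by rewrite gtn_min => /orP[/IHx|/IHy].
by right; exists i.
Qed.

Lemma bigminn_eqP :
  \big[minn/n]_(j | P j) F j = n
  \/ exists2 i, P i & \big[minn/n]_(j | P j) F j = F i.
Proof.
elim/big_ind: _ => [|x y IHx IHy|i Pi]; first by left.
  by rewrite /minn; case: ifP.
by right; exists i.
Qed.

End BigMin.

(** * Dominating pairs, and what criticality says about nonadjacent vertices *)

Section Critical.

Variables (T : finType) (e : rel T).
Hypotheses (e_sym : symmetric e) (e_irr : irreflexive e).

Definition pair_dom x y z := [\/ z = x, z = y, e x z | e y z].

(* Written [{u, z} ->_c v] in the literature. *)
Definition dom_but u z v :=
  [/\ e u z, ~ pair_dom u z v & forall x, x <> v -> pair_dom u z x].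

Lemma pair_domC x y z : pair_dom x y z -> pair_dom y x z.
Proof. by case=> ?; [constructor 2|constructor 1|constructor 4|constructor 3]. Qed.

Lemma connected_on_pair x y : e x y -> connected_on e [set x; y].
Proof.
move=> exy; apply/forall_inP => a aD; apply/forall_inP => b bD.
move: aD bD; rewrite !inE => /orP[]/eqP-> /orP[]/eqP->; rewrite ?connect0 //;
  apply: connect1; rewrite /induced /= ?(set21, set22) /= ?exy //.
by rewrite e_sym.
Qed.

Lemma pair_connected_on (e' : rel T) x y :
  irreflexive e' -> x <> y -> connected_on e' [set x; y] -> e' x y.
Proof.
move=> irr neq /forall_inP/(_ x (set21 x y))/forall_inP/(_ y (set22 x y)).
case/connectP => -[|z p] /=; first by move=> _ /esym.
case/andP=> /and3P[_ zD exz] _ _; move: zD exz; rewrite !inE.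
by case/orP=> /eqP-> //; rewrite irr.
Qed.

(** The bound on [#|T|] excludes the default value of [gamma_c] and the empty dominating set. The
    case [p = q] covers a single dominating vertex. *)
Lemma gamma_c_le2P (e' : rel T) :
  irreflexive e' -> 3 <= #|T| -> gamma_c e' < 3 ->
  exists p q, (p = q \/ e' p q)
    /\ forall x, [\/ x = p, x = q, e' x p | e' x q].
Proof.
move=> irr ge3 /bigminn_ltP[|[D /andP[/forallP domD conD] lt3]].
  by rewrite ltnNge ge3.
have domE x : x \in D \/ exists2 y, y \in D & e' x y.
  by case/orP: (domD x) => [|/exists_inP]; [left | right].
have [p pD] : exists p, p \in D.
  have/card_gt0P : 0 < #|T| by apply: leq_trans ge3.
  by case=> x _; case: (domE x) => [|[y]]; [exists x | exists y].
have [q Dpq] : exists q, D = [set p; q].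
  have : #|D :\ p| <= 1 by move: lt3; rewrite (cardsD1 p) pD.
  rewrite leq_eqVlt ltnS leqn0 => /orP[/cards1P[q Dq]|/eqP/cards0_eq D0].
    by exists q; rewrite -(setD1K pD) Dq.
  by exists p; rewrite -(setD1K pD) D0 setU0 setUid.
exists p, q; split.
  case: (eqVneq p q) => [->|/eqP neq]; [by left | right].
  by apply: pair_connected_on; rewrite -?Dpq.
move=> x; case: (domE x); rewrite Dpq.
  by rewrite !inE => /orP[]/eqP; [constructor 1 | constructor 2].
by case=> y; rewrite !inE => /orP[]/eqP->; [constructor 3 | constructor 4].
Qed.

Section FromCritical.

Hypothesis crit : gamma_c_critical3 e.
Hypothesis has_nbr : forall x, exists y, e x y.

Lemma edge_not_dom x y : e x y -> ~ forall z, pair_dom x y z.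
Proof.
move=> exy dom; have [g3 _] := crit.
suff: gamma_c e <= #|[set x; y]| by rewrite g3 cards2; case: (x != y).
apply: bigminn_le; rewrite /connected_dominating connected_on_pair // andbT.
apply/forallP => z; rewrite !inE; have: pair_dom x y z by [].
case=> [->|->|exz|eyz]; rewrite ?eqxx ?orbT //; apply/orP; right.
  by apply/exists_inP; exists x; rewrite ?inE ?eqxx // e_sym.
by apply/exists_inP; exists y; rewrite ?inE ?eqxx ?orbT // e_sym.
Qed.

(** A connected dominating set [{p, q}] of the graph with [u v] added cannot work in the graph
    itself. So either it is [{u, v}], or it contains one of [u], [v] and dominates the other only
    through the new edge. Together with [edge_not_dom], this is all that the later sections use of
    criticality. *)
Lemma nonadjacent_dom u v : u <> v -> e u v = false ->
  [\/ forall x, pair_dom u v x, exists z, dom_but u z v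
    | exists z, dom_but v z u].
Proof.
move=> /eqP neq euv; have [g3 /(_ u v neq)] := crit; rewrite euv => /(_ isT) lt3.
have ge3 : 3 <= #|T| by rewrite -g3; apply: bigminn_le_idx.
have irr' : irreflexive (add_edge e u v).
  move=> x; rewrite /add_edge /= e_irr /=; apply/negbTE; rewrite andbC orbb.
  by apply: contra neq => /andP[/eqP-> /eqP->].
have addE x y : add_edge e u v x y -> e y x \/ (x = u /\ y = v \/ x = v /\ y = u).
  rewrite /add_edge /= e_sym => /or3P[]; first by left.
    by move/andP=> [/eqP-> /eqP->]; right; left.
  by move/andP=> [/eqP-> /eqP->]; right; right.
have [p [q [pq dom]]] := gamma_c_le2P irr' ge3 lt3.
have {}neq := elimN eqP neq.
(* Domination through the new edge concerns only [u] and [v]. *)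
have domE x : pair_dom p q x \/
    (x = u /\ (p = v \/ q = v)) \/ (x = v /\ (p = u \/ q = u)).
  case: (dom x) => [->|->|/addE[]|/addE[]].
  - by left; constructor 1.
  - by left; constructor 2.
  - by left; constructor 3.
  - by case=> -[-> ->]; right; [left | right]; split=> //; left.
  - by left; constructor 4.
  - by case=> -[-> ->]; right; [left | right]; split=> //; right.
have NE := edge_not_dom.
case: pq => [eq_pq|/addE].
  (* A single dominating vertex always extends to a dominating edge: add a neighbour of the endpoint
     that it may fail to dominate, or any neighbour if it is not an endpoint. *)
  subst q.
  have D1 x : x <> u -> x <> v -> x = p \/ e p x.
    by move=> xu xv; case: (domE x) => [[]|[[]|[]]] //; [left|left|right|right].
  case: (eqVneq p u) => [pu|/eqP pu]; last case: (eqVneq p v) => [pv|/eqP pv].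
  - subst p; have [y evy] := has_nbr v.
    have yu : y <> u by move=> E; subst y; rewrite e_sym euv in evy.
    have yv : y <> v by move=> E; subst y; rewrite e_irr in evy.
    case: (D1 y yu yv) => // euy; case: (NE _ _ euy) => x.
    case: (eqVneq x u) => [->|/eqP xu]; first by constructor 1.
    case: (eqVneq x v) => [->|/eqP xv]; first by constructor 4; rewrite e_sym.
    by case: (D1 x xu xv) => ?; [constructor 1|constructor 3].
  - subst p; have [y euy] := has_nbr u.
    have yv : y <> v by move=> E; subst y; rewrite euv in euy.
    have yu : y <> u by move=> E; subst y; rewrite e_irr in euy.
    case: (D1 y yu yv) => // evy; case: (NE _ _ evy) => x.
    case: (eqVneq x u) => [->|/eqP xu]; first by constructor 4; rewrite e_sym.
    case: (eqVneq x v) => [->|/eqP xv]; first by constructor 1.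
    by case: (D1 x xu xv) => ?; [constructor 1|constructor 3].
  - have [y epy] := has_nbr p; case: (NE _ _ epy) => x.
    by case: (domE x) => [[]|[[_ []]|[_ []]]] // ?;
      [constructor 1|constructor 1|constructor 3|constructor 3].
rewrite e_sym => -[epq|]; last first.
  case=> -[? ?]; subst p q; constructor 1 => x; case: (domE x) => //.
  - by case=> -[-> _]; [constructor 1 | constructor 2].
  - by move/pair_domC.
  - by case=> -[-> _]; [constructor 1 | constructor 2].
(* An adjacent pair dominating all vertices but possibly [c] does miss [c], by [edge_not_dom]. *)
have key a b c : e a b -> (forall x, x <> c -> pair_dom a b x) -> dom_but a b c.
  move=> eab D; split=> // Dc; apply: (NE _ _ eab) => x.
  by case: (eqVneq x c) => [->|/eqP/D].
case: (eqVneq p u) => [pu|/eqP pu].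
  subst p; constructor 2; exists q; apply: key => // x xv.
  by case: (domE x) => // -[[_ []]|[]] // E; subst q; rewrite euv in epq.
case: (eqVneq q u) => [qu|/eqP qu].
  subst q; constructor 2; exists p; apply: key => [|x xv]; first by rewrite e_sym.
  case: (domE x) => [/pair_domC//|] -[[_ []]|[]] // E; subst p.
  by rewrite e_sym euv in epq.
case: (eqVneq p v) => [pv|/eqP pv].
  subst p; constructor 3; exists q; apply: key => // x xu.
  by case: (domE x) => // -[[]|[_ []]].
case: (eqVneq q v) => [qv|/eqP qv].
  subst q; constructor 3; exists p; apply: key => [|x xu]; first by rewrite e_sym.
  by case: (domE x) => [/pair_domC//|] -[[]|[_ []]].
by case: (NE _ _ epq) => x; case: (domE x) => // -[[_ []]|[_ []]].
Qed.

End FromCritical.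

(** The sides need not be connected, only free of edges between them. The two neighbour fields carry
    what the degree bound provides, and the symmetry in [A] and [B] lets each argument be used on
    either side. *)
Record separation (S A B : {set T}) : Prop := Separation {
  sep_cover : forall x, [\/ x \in S, x \in A | x \in B];
  sep_SA : forall x, x \in S -> (x \in A) = false;
  sep_SB : forall x, x \in S -> (x \in B) = false;
  sep_AB : forall x, x \in A -> (x \in B) = false;
  sep_edge : forall x y, x \in A -> y \in B -> e x y = false;
  sep_nbrA : forall x, x \in A -> exists2 y, y \in A & e x y;
  sep_nbrB : forall x, x \in B -> exists2 y, y \in B & e x y;
  sep_A : exists x, x \in A;
  sep_B : exists x, x \in B }.

Lemma separationC S A B : separation S A B -> separation S B A.
Proof.
case=> cov SA SB AB ed nA nB hA hB; split=> // x.
- by case: (cov x) => ?; [constructor 1 | constructor 3 | constructor 2].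
- by move=> xB; apply/negP => /AB; rewrite xB.
- by move=> y xB yA; rewrite e_sym ed.
Qed.

Hypothesis edgeN : forall x y, e x y -> ~ forall z, pair_dom x y z.
Hypothesis nonadjN : forall u v, u <> v -> e u v = false ->
  [\/ forall x, pair_dom u v x, exists z, dom_but u z v
    | exists z, dom_but v z u].

Ltac note t :=
  let P := type of t in
  match goal with H : P |- _ => fail 1 | _ => pose proof t end.

(* Saturates the context with the (non)adjacencies forced by [sp] and [indep],
   and looks for a Boolean known to be both true and false. *)
Ltac graph0 sp indep :=
  intros;
  lazymatch goal with
  | |- is_true _ => apply/negPn/negP; move/negbTE; intro
  | |- _ = false => apply/negbTE/negP; intro
  | |- _ => idtac
  end;
  repeat match goal with H : ?b = true |- _ => change (is_true b) in H end;
  repeat match goal with E : ?x = ?y |- _ => first [subst x | subst y] end;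
  repeat match goal with
  | H : is_true ?b, K : ?b = false |- _ =>
      exfalso; exact (Bool.diff_true_false (eq_trans (esym H) K))
  | H : ?x <> ?x |- _ => case: (H erefl)
  | H : is_true (_ \in _) |- _ =>
      first [note (sep_SA sp H) | note (sep_SB sp H) | note (sep_AB sp H)]
  | H : is_true (?x \in _), K : is_true (?y \in _) |- _ =>
      first [note (sep_edge sp H K) | note (indep x y H K)]
  | H : is_true (e ?x ?x) |- _ => rewrite e_irr in H; discriminate H
  | H : is_true (e ?x ?y) |- _ =>
      note (etrans (e_sym y x) H : is_true (e y x))
  end.

(** * Domination across a cut *)

Section Sep.

Variables S A B : {set T}.
Hypothesis sp : separation S A B.

(** A vacuous stand-in for the independence argument of [graph0]. *)
Let indep0 (x y : T) : x \in S -> y \in S -> True. Proof. by []. Qed.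
Ltac graph := graph0 sp indep0.

(** The side [B] has two vertices, so one of them differs from [v] and must be dominated by [z].
    This excludes [z] in [A], and the edge [u z] excludes [z] in [B]. *)
Lemma dom_but_cut u z v : u \in A -> dom_but u z v -> z \in S.
Proof.
move=> uA [uz _ dom].
case: (sep_cover sp z) => // zAB; last by graph.
have [b bB bv] : exists2 b, b \in B & b <> v.
  have [b bB] := sep_B sp; have [b' b'B bb'] := sep_nbrB sp bB.
  case: (eqVneq b v) => [bv|/eqP]; [exists b' | by exists b] => //.
  by move=> b'v; graph.
by case: (dom b bv) => ?; graph.
Qed.

End Sep.

Lemma dom_but_cut_out S A B u z v :
  separation S A B -> u \notin S -> dom_but u z v -> z \in S.
Proof.
move=> sp uS; case: (sep_cover sp u) => [|uA|uB]; first by rewrite (negPf uS).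
  exact: (dom_but_cut sp uA).
exact: (dom_but_cut (separationC sp) uB).
Qed.

(** * An independent set with one element more than the cut *)

Section IndependentSet.

Variable I : {set T}.
Hypothesis indep : forall x y, x \in I -> y \in I -> e x y = false.
Hypothesis I_ge3 : 3 <= #|I|.

Lemma indep_pair_not_dom a b :
  a \in I -> b \in I -> ~ forall x, pair_dom a b x.
Proof.
move=> aI bI dom; have : 0 < #|I :\: [set a; b]|.
  have := cardsID [set a; b] I; have := subset_leq_card (subsetIr I [set a; b]).
  by rewrite cards2; case: (a != b); lia.
case/card_gt0P=> c; rewrite !inE negb_or -andbA => /and3P[ca cb cI].
case: (dom c) => [E|E||]; rewrite ?indep //.
  by rewrite E eqxx in ca.
by rewrite E eqxx in cb.
Qed.

(** Inside [I] the vertex [a] dominates only itself, so [z] has to take care of all other elements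
    except [b]. *)
Lemma dom_but_indep a z b : a \in I -> dom_but a z b ->
  [/\ z \notin I, e z b = false & forall c, c \in I -> c <> b -> e z c].
Proof.
move=> aI [az Nb dom].
have zI : z \notin I by apply/negP => zI; rewrite indep in az.
split=> // [|c cI cb]; first by apply/negP => zb; apply: Nb; constructor 4.
case: (dom c cb) => [->|E||//]; first by rewrite e_sym.
  by rewrite E (negPf zI) in cI.
by rewrite indep.
Qed.

Variables S A B : {set T}.
Hypothesis sp : separation S A B.
Hypothesis cardI : #|I| = #|S|.+1.

(** The vertex [a] is the unique element of [I] not adjacent to [z], so each [z] misses at most one
    element of [I]. *)
Let misses z a :=
  [&& z \in S :\: I, ~~ e z a & [forall c in I, (c != a) ==> e z c]].

Let missesP z a : reflect
  [/\ z \in S :\: I, e z a = false & forall c, c \in I -> c <> a -> e z c]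
  (misses z a).
Proof.
apply: (iffP and3P) => -[zSI za zI]; split=> //; first exact/negbTE.
- by move=> c cI /eqP ca; have/implyP->// := forall_inP zI c cI.
- by rewrite za.
- by apply/forall_inP => c cI; apply/implyP => /eqP ca; exact: zI.
Qed.

Let misses_inj z a b : a \in I -> b \in I -> misses z a -> misses z b -> a = b.
Proof.
move=> aI bI /missesP[_ za _] /missesP[_ _ zI].
by apply/eqP/negPn/negP => /eqP ab; rewrite zI in za.
Qed.

(** The default [a] is a dummy, returned only if nothing misses [a]. *)
Let f a := odflt a [pick z | misses z a].

Let f_misses a : (exists z, misses z a) -> misses (f a) a.
Proof. by case=> z za; rewrite /f; case: pickP => [//|/(_ z)]; rewrite za. Qed.

Let card_outside : #|I :\: S| = #|S :\: I|.+1.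
Proof.
have := cardsID S I; have := cardsID I S; rewrite [S :&: I]setIC; lia.
Qed.

(* Two vertices of [I] outside the cut are not both unmissed, and there are too
   few vertices in [S :\: I] for all of [I :\: S] to be missed, so the counting
   is tight: all but one vertex of [I :\: S] correspond to [S :\: I]. *)
Lemma indep_matching : exists a0 (f : T -> T),
  [/\ a0 \in I :\: S,
      forall a, a \in I :\: S -> a <> a0 ->
        f a \in S :\: I /\ dom_but a0 (f a) a
    & forall z, z \in S :\: I -> exists a, [/\ a \in I :\: S, a <> a0 & z = f a]].
Proof.
have f_inj (D : {set T}) : D \subset I -> {in D, forall a, misses (f a) a} ->
    {in D &, injective f}.
  move=> /subsetP DI mis a b aD bD Eab.
  apply: (@misses_inj (f a)); rewrite ?DI ?mis // Eab; exact: mis.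
have f_sub (D : {set T}) : {in D, forall a, misses (f a) a} ->
    f @: D \subset S :\: I.
  by move=> mis; apply/subsetP => _ /imsetP[a /mis/missesP[]] ? _ _ ->.
(* If every element of [I :\: S] were missed, [f] would inject it into the smaller set [S :\: I]. *)
have [a0 a0IS Na0] : exists2 a0, a0 \in I :\: S & ~ exists z, misses z a0.
  have [/exists_inP[a aIS Na]|all_mis] :=
      boolP [exists a in I :\: S, ~~ [exists z, misses z a]].
    by exists a => // /existsP Ea; rewrite Ea in Na.
  have mis : {in I :\: S, forall a, misses (f a) a}.
    move=> a aIS; apply/f_misses/existsP.
    by apply: contraR all_mis => Na; apply/exists_inP; exists a.
  have := subset_leq_card (f_sub _ mis).
  by rewrite (card_in_imset (f_inj _ (subsetDl _ _) mis)) card_outside ltnn.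
have [a0I a0S] : a0 \in I /\ a0 \notin S by case/setDP: a0IS.
have misE u z v : u \in I :\: S -> dom_but u z v -> misses z v.
  case/setDP => uI uS D; have [zI zv zall] := dom_but_indep uI D.
  by apply/missesP; rewrite inE zI (dom_but_cut_out sp uS D).
have crit a : a \in I :\: S -> a <> a0 -> exists z, dom_but a0 z a.
  move=> aIS aa0; have [aI aS] := setDP aIS.
  case: (nonadjN (nesym aa0)) => [|dom|//|[z /misE mis]].
  - exact: indep.
  - by case: (indep_pair_not_dom a0I aI).
  - by case: Na0; exists z; apply: mis.
pose D := (I :\: S) :\ a0.
have DE a : (a \in D) -> a \in I :\: S /\ a <> a0.
  by rewrite in_setD1 => /andP[/eqP].
have misD : {in D, forall a, misses (f a) a}.
  move=> a /DE[aIS aa0]; apply: f_misses.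
  by have [z za] := crit a aIS aa0; exists z; apply: misE za.
have DI : D \subset I by apply: subset_trans (subsetDl _ _) (subsetDl _ _).
have fD : f @: D = S :\: I.
  apply/eqP; rewrite eqEcard f_sub // (card_in_imset (f_inj _ DI misD)).
  by have := card_outside; rewrite (cardsD1 a0) a0IS -/D; lia.
exists a0, f; split=> // [a aIS aa0|z]; last first.
  by rewrite -fD => /imsetP[a /DE[aIS aa0] ->]; exists a.
have aD : a \in D by rewrite in_setD1 aIS andbT; apply/eqP.
split; first by rewrite -fD imset_f.
(* The witness [z] from criticality is [f a] itself: by surjectivity [z = f b] for some [b], and [z]
   misses both [a] and [b]. *)
have [z za] := crit a aIS aa0; have mza := misE _ _ _ a0IS za.
have : z \in f @: D by rewrite fD; case/missesP: mza.
case/imsetP=> b bD Ez; suff Eab : a = b by rewrite -Eab in Ez; rewrite -Ez.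
by apply: (@misses_inj z); rewrite ?(subsetP DI) // Ez misD.
Qed.

End IndependentSet.

(** * Adjacencies forced by [a0] and the matching, and recognition of the graph *)

Section Structure.

Variables (I S A B : {set T}) (a0 : T) (f : T -> T).
Hypothesis indep : forall x y, x \in I -> y \in I -> e x y = false.
Hypothesis I_ge3 : 3 <= #|I|.
Hypothesis cardI : #|I| = #|S|.+1.
Hypothesis sp : separation S A B.
Hypotheses (a0A : a0 \in A) (a0I : a0 \in I).
Hypothesis f_dom : forall a, a \in I -> (a \in S) = false -> a <> a0 ->
  [/\ f a \in S, (f a \in I) = false & dom_but a0 (f a) a].
Hypothesis f_onto : forall z, z \in S -> (z \in I) = false ->
  exists a, [/\ a \in I, (a \in S) = false, a <> a0 & z = f a].

Ltac graph := graph0 sp indep.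

Lemma f_edge a c : a \in I -> (a \in S) = false -> a <> a0 ->
  [/\ e (f a) a = false & c \in I -> c <> a -> e (f a) c].
Proof.
move=> aI aS aa0; have [_ _ D] := f_dom aI aS aa0.
by have [_ ? H] := dom_but_indep indep a0I D; split=> //; exact: H.
Qed.

(** Apply criticality to [a0] and [x]. A witness paired with [a0] is some [f a], and then [a] is
    undominated. A witness paired with [x] must lie in [I], since each [f a] is adjacent to [a0], so
    [c] is left to [x]. If [a0] and [x] dominate, [c] is left to [x] as well. *)
Lemma B_nbr_indep x c :
  x \in B -> (x \in I) = false -> c \in I -> c <> a0 -> e x c.
Proof.
move=> xB xI cI ca0; have xa0 : a0 <> x by move=> ?; graph.
case: (nonadjN xa0) => [|dom|[z D]|[z D]].
- by graph.
- by case: (dom c) => ? //; graph.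
- have zS := dom_but_cut sp a0A D; case: D => a0z ND dom.
  have zI : (z \in I) = false by apply/negP => ?; graph.
  have [a [aI aS aa0 Ez]] := f_onto zS zI.
  have [za _] := f_edge a aI aS aa0; rewrite -Ez in za; clear Ez.
  have ax : a <> x by move=> ?; graph.
  by case: (dom a ax) => ?; graph.
- have zS := dom_but_cut (separationC sp) xB D; case: D => xz ND dom.
  case zI: (z \in I); last first.
    have [a [aI aS aa0 Ez]] := f_onto zS zI.
    have [_ za0] := f_edge a0 aI aS aa0; rewrite -Ez in za0; clear Ez.
    by case: ND; constructor 4; apply: za0 => // ?; graph.
  by case: (dom c ca0) => [?|->|//|?] //; graph.
Qed.

(** If [z] is outside [I], it is some [f a], and [a0] in [A] cannot dominate [x], so [f a] does. *)
Lemma B_nbr_cut x z : x \in B -> (x \in I) = false -> z \in S -> e x z.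
Proof.
move=> xB xI zS; case zI: (z \in I).
  by apply: B_nbr_indep => // ?; graph.
have [a [aI aS aa0 ->]] := f_onto zS zI; have [faS _ [_ _ dom]] := f_dom aI aS aa0.
have xa : x <> a by move=> ?; graph.
by case: (dom x xa) => ?; rewrite 1?e_sym //; graph.
Qed.

Lemma B_outside_indep : exists2 x, x \in B & (x \in I) = false.
Proof.
have [x xB] := sep_B sp; have [y yB xy] := sep_nbrB sp xB.
case xI: (x \in I); last by exists x.
by exists y => //; apply/negP => yI; graph.
Qed.

Lemma indep_in_B a : a \in I -> (a \in S) = false -> a <> a0 -> a \in B.
Proof.
move=> aI aS aa0; have [x xB xI] := B_outside_indep.
have xa := B_nbr_indep xB xI aI aa0.
by case: (sep_cover sp a) => ? //; graph.
Qed.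

Lemma f_dom_B a z x : a \in I -> (a \in S) = false -> a <> a0 -> z = f a ->
  x \in B -> x <> a -> e z x.
Proof.
move=> aI aS aa0 -> xB xa; have [faS _ [_ _ dom]] := f_dom aI aS aa0.
by case: (dom x xa) => ? //; graph.
Qed.

(* Otherwise [x] and [f a] would dominate, for any [x] in [B :\: I]. *)
Lemma f_misses_A a : a \in I -> (a \in S) = false -> a <> a0 ->
  exists2 y, y \in A & e (f a) y = false.
Proof.
move=> aI aS aa0; have [fS fI _] := f_dom aI aS aa0.
have [/exists_inP[y yA /negbTE]|all_A] := boolP [exists y in A, ~~ e (f a) y].
  by exists y.
have [x xB xI] := B_outside_indep.
case: (edgeN (B_nbr_cut xB xI fS)) => y.
case: (sep_cover sp y) => yP.
- by constructor 3; apply: B_nbr_cut.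
- constructor 4; apply/negPn/negP => N; case/negP: all_A.
  by apply/exists_inP; exists y.
- case: (eqVneq y a) => [->|/eqP ya]; first by constructor 3; apply: B_nbr_indep.
  by constructor 4; apply: (f_dom_B aI aS aa0).
Qed.

(** Criticality fails for [a1] and a vertex [y] of [A] missed by [f a1]. A witness paired with [y]
    dominates [a2], so it is some [f a]; it must differ from [f a1] and hence is adjacent to [a1]. A
    witness paired with [a1] is some [f a] again, which leaves [a] undominated. *)
Lemma indep_B_uniq a1 a2 :
  a1 \in I -> (a1 \in S) = false -> a1 <> a0 ->
  a2 \in I -> (a2 \in S) = false -> a2 <> a0 -> a1 = a2.
Proof.
move=> a1I a1S a10 a2I a2S a20; apply/eqP/negPn/negP => /eqP a12.
have [y yA fy] := f_misses_A a1I a1S a10.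
have a1B := indep_in_B a1I a1S a10; have a2B := indep_in_B a2I a2S a20.
have ya1 : y <> a1 by move=> ?; graph.
case: (nonadjN ya1) => [|dom|[z D]|[z D]]; first by graph.
- by case: (dom a2) => ?; graph.
- have zS := dom_but_cut sp yA D; case: D => yz ND dom.
  have za2 : e z a2 by case: (dom a2 (nesym a12)) => ? //; graph.
  have zI : (z \in I) = false by apply/negP => ?; graph.
  have [a [aI aS aa0 Ez]] := f_onto zS zI.
  have [_ za1] := f_edge a1 aI aS aa0.
  case: (eqVneq a a1) => [aa1|/eqP aa1]; first by subst a z; graph.
  by apply: ND; constructor 4; rewrite Ez; apply: za1 => // ?; graph.
- have zS := dom_but_cut (separationC sp) a1B D; case: D => a1z ND dom.
  have zI : (z \in I) = false by apply/negP => ?; graph.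
  have [a [aI aS aa0 Ez]] := f_onto zS zI.
  have [za _] := f_edge a aI aS aa0; rewrite -Ez in za; clear Ez.
  have aB := indep_in_B aI aS aa0.
  have ay : a <> y by move=> ?; graph.
  by case: (dom a ay) => ?; graph.
Qed.

(** Otherwise [S] lies in [I] and [B] avoids [I]. Then each vertex of [A] other than [a0] is
    adjacent to the rest of [A] and to all of [S], so together with a vertex of [S], which is
    adjacent to all of [B], it forms a dominating edge. *)
Lemma indep_B_ex : exists a1, [/\ a1 \in I, (a1 \in S) = false & a1 <> a0].
Proof.
have [/exists_inP[a aI /andP[aS /eqP aa0]]|no_a] :=
  boolP [exists a in I, (a \notin S) && (a != a0)].
  by exists a; split=> //; apply: negbTE.
exfalso; have noa a : a \in I -> (a \in S) = false -> a <> a0 -> False.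
  move=> aI aS /eqP aa0; case/negP: no_a; apply/exists_inP; exists a => //.
  by rewrite aS.
have SI z : z \in S -> z \in I.
  move=> zS; apply/negPn/negP => /negbTE zI.
  by have [a [aI aS aa0 _]] := f_onto zS zI; apply: (noa a).
have BI x : x \in B -> (x \in I) = false.
  by move=> xB; apply/negP => xI; apply: (noa x) => //; [|move=> ?]; graph.
have dom_AB x y : x \in B -> y \in A -> y <> a0 -> forall v, pair_dom x y v.
  move=> xB yA ya0; have xI := BI x xB; have xy : x <> y by move=> ?; graph.
  case: (nonadjN xy) => [|//|[z D]|[z D]]; first by graph.
    have zS := dom_but_cut (separationC sp) xB D; case: D => xz ND dom.
    by have zI := SI z zS; case: (dom a0 (nesym ya0)) => ?; graph.
  have zS := dom_but_cut sp yA D; case: D => yz ND dom.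
  by case: ND; constructor 4; rewrite e_sym; apply: B_nbr_cut.
have [x xB] := sep_B sp; have xI := BI x xB.
have cliqueA y v : y \in A -> y <> a0 -> v \in A -> v <> y -> e y v.
  by move=> yA ya0 vA vy; case: (dom_AB x y xB yA ya0 v) => ? //; graph.
have S_A b y : b \in S -> y \in A -> y <> a0 -> e b y.
  move=> bS yA ya0; have bI := SI b bS; have ba0 : b <> a0 by move=> ?; graph.
  case: (nonadjN ba0) => [|dom|[z [bz ND dom]]|[z D]]; first by graph.
  - by case: (indep_pair_not_dom indep I_ge3 bI a0I).
  - case: (sep_cover sp z) => zP; first by have zI := SI z zP; graph.
      have za0 : z <> a0 by move=> ?; graph.
      by case: ND; constructor 4; apply: cliqueA => // ?; graph.
    by case: (dom y ya0) => ? //; graph.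
  - have zS := dom_but_cut sp a0A D; case: D => a0z _ _.
    by have zI := SI z zS; graph.
have [b bS] : exists b, b \in S by apply/card_gt0P; move: I_ge3; lia.
have [y yA a0y] := sep_nbrA sp a0A; have ya0 : y <> a0 by move=> ?; graph.
case: (edgeN (S_A b y bS yA ya0)) => v.
case: (eqVneq v y) => [->|/eqP vy]; first by constructor 2.
case: (sep_cover sp v) => vP.
- by constructor 4; rewrite e_sym S_A.
- by constructor 4; apply: cliqueA.
- by constructor 3; rewrite e_sym; apply: B_nbr_cut => //; exact: BI.
Qed.

(** The labelling is [J1 = B :\ a1], [J2 = A], [u1 = a0], [v1 = a1], with [w = f a1], [u2] a vertex
    of [A] missed by [w], and [w1] the other vertex of [S]. *)
Lemma indep_in_G2_33 : (forall x, #|S| < degree e x) -> in_G2_33 e.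
Proof.
move=> deg; have [a1 [a1I a1S a10]] := indep_B_ex.
have a1B := indep_in_B a1I a1S a10.
have uniq1 a : a \in I -> (a \in S) = false -> a <> a0 -> a = a1.
  by move=> *; apply: indep_B_uniq.
have [wS wI [a0w Na1 dom_w]] := f_dom a1I a1S a10.
have [wa1 _] := f_edge a1 a1I a1S a10.
have w_I c : c \in I -> c <> a1 -> e (f a1) c by have [] := f_edge c a1I a1S a10.
have [u2 u2A wu2] := f_misses_A a1I a1S a10.
have w_B x : x \in B -> x <> a1 -> e (f a1) x by apply: f_dom_B.
have w_uniq z : z \in S -> (z \in I) = false -> z = f a1.
  by move=> zS zI; have [a [aI aS aa0 ->]] := f_onto zS zI; rewrite (uniq1 a).
move: (f a1) wS wI a0w Na1 dom_w wa1 w_I wu2 w_B w_uniq => w.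
move=> wS wI a0w Na1 dom_w wa1 w_I wu2 w_B w_uniq.
have S_ge2 : 2 <= #|S| by rewrite -ltnS -cardI.
have [w1 w1S w1w] : exists2 w1, w1 \in S & w1 <> w.
  have : 0 < #|S :\ w| by move: S_ge2; rewrite (cardsD1 w) wS.
  by case/card_gt0P=> b; rewrite !inE => /andP[/eqP ? ?]; exists b.
have w1I : w1 \in I by apply/negPn/negP => /negbTE/(w_uniq _ w1S).
(* Two elements of [S] in [I] would need a witness [z] adjacent to both [a0] and [a1]. Such a [z]
   lies in [S :\: I], so it is [w], which misses [a1]. *)
have w1_uniq b : b \in S -> b <> w -> b = w1.
  move=> bS bw; have bI : b \in I by apply/negPn/negP => /negbTE/(w_uniq _ bS).
  apply/eqP/negPn/negP => /eqP bw1.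
  suff nope p q : p \in I -> q \in I -> p \in S -> q \in S -> ~ exists z, dom_but p z q.
    case: (nonadjN bw1); first by graph.
    - by move/(indep_pair_not_dom indep I_ge3 bI w1I).
    - exact: nope.
    - exact: nope.
  move=> pI qI pS qS [z D]; have [/negbTE zI _ zc] := dom_but_indep indep pI D.
  have za0 : e z a0 by apply: zc => // ?; graph.
  have za1 : e z a1 by apply: zc => // ?; graph.
  case: (sep_cover sp z) => zP; [|by graph|by graph].
  by have zw := w_uniq z zP zI; graph.
have ww1 : e w w1 by apply: w_I => // ?; graph.
(* Criticality for [w1] and [a0] leaves only a witness in [B] paired with [w1], so [w1] alone
   dominates the rest of [A]. *)
have w1A y : y \in A -> y <> a0 -> e w1 y.
  move=> yA ya0; have w1a0 : w1 <> a0 by move=> ?; graph.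
  case: (nonadjN w1a0) => [|dom|[z D]|[z D]]; first by graph.
  - by case: (indep_pair_not_dom indep I_ge3 w1I a0I).
  - have [/negbTE zI _ zc] := dom_but_indep indep w1I D.
    have za1 : e z a1 by exact: zc.
    case: D => w1z ND dom; case: (sep_cover sp z) => zP; [|by graph|].
      by have zw := w_uniq z zP zI; graph.
    by case: (dom y ya0) => ? //; graph.
  - have zS := dom_but_cut sp a0A D; have [/negbTE zI zw1 _] := dom_but_indep indep a0I D.
    by have zw := w_uniq z zS zI; graph.
have a1N z : e z a1 -> z \in B.
  move=> za1; case: (sep_cover sp z) => zP //; last by graph.
  by case: (eqVneq z w) => [?|/eqP/(w1_uniq _ zP) ?]; graph.
(* The vertex [a1] has neighbours only in [B], so criticality for [u2] and [w] needs a witness in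
   [B], paired with [w]. *)
have wA y : y \in A -> y <> u2 -> e w y.
  move=> yA yu2; have u2w : u2 <> w by move=> ?; graph.
  case: (nonadjN u2w) => [|dom|[z [u2z ND dom]]|[z [wz ND dom]]].
  - by rewrite e_sym.
  - by case: (dom a1) => ?; graph.
  - have a1w : a1 <> w by move=> ?; graph.
    by case: (dom a1 a1w) => [?|?|?|/a1N ?]; graph.
  - have a1u2 : a1 <> u2 by move=> ?; graph.
    have zB : z \in B by case: (dom a1 a1u2) => [?|?|?|/a1N ?] //; graph.
    by case: (dom y yu2) => ? //; graph.
have cliqueA y v : y \in A -> v \in A -> y <> v -> e y v.
  suff nope p q : p \in A -> q \in A -> ~ exists z, dom_but p z q.
    move=> yA vA yv; apply/negPn/negP => /negbTE yvF.
    case: (nonadjN yv yvF) => [dom||]; [|exact: nope|exact: nope].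
    by case: (dom a1) => ?; graph.
  move=> pA qA [z [pz ND dom]]; have a1q : a1 <> q by move=> ?; graph.
  by case: (dom a1 a1q) => [?|?|?|/a1N ?]; graph.
have BI x : x \in B -> x <> a1 -> (x \in I) = false.
  by move=> xB xa1; apply/negP => xI; apply: xa1; apply: uniq1 => //; [|move=> ?]; graph.
have B_S x z : x \in B -> x <> a1 -> z \in S -> e x z.
  by move=> xB xa1 zS; apply: B_nbr_cut => //; apply: BI.
have B_a1 x : x \in B -> x <> a1 -> e x a1.
  by move=> xB xa1; apply: B_nbr_indep => //; apply: BI.
(* A witness for two vertices of [B] other than [a1] would lie in [S], to which both are completely
   joined; the two together do not dominate [a0]. *)
have cliqueB x v : x \in B -> v \in B -> x <> v -> e x v.
  case: (eqVneq x a1) => [->|/eqP xa1].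
    by move=> _ vB a1v; rewrite e_sym; apply: B_a1 => // ?; apply: a1v.
  case: (eqVneq v a1) => [->|/eqP va1]; first by move=> xB _ _; exact: B_a1.
  suff nope p q : p \in B -> q \in B -> q <> a1 -> ~ exists z, dom_but p z q.
    move=> xB vB xv; apply/negPn/negP => /negbTE xvF.
    case: (nonadjN xv xvF) => [dom||]; [|exact: nope|exact: nope].
    by case: (dom a0) => ?; graph.
  move=> pB qB qa1 [z D]; have zS := dom_but_cut (separationC sp) pB D.
  case: D => pz ND dom; apply: ND; constructor 4; rewrite e_sym.
  exact: B_S.
have u2a0 : u2 <> a0 by move=> ?; graph.
have S2 : #|S| = 2.
  suff -> : S = [set w; w1] by rewrite cards2 (introN eqP (nesym w1w)).
  apply/setP => z; rewrite !inE; apply/idP/orP => [zS|[]/eqP-> //].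
  by case: (eqVneq z w) => [|/eqP/(w1_uniq _ zS)->]; [left | right].
have neq (x y : T) : x <> y -> (x == y) = false by move/eqP/negbTE.
have neqS x y : x \in S -> y \in A \/ y \in B -> (y == x) = false.
  by move=> xS [] yP; apply: neq => ?; graph.
have [w1A' w1B'] := (sep_SA sp w1S, sep_SB sp w1S).
have [wA' wB'] := (sep_SA sp wS, sep_SB sp wS).
have w1w' := neq _ _ w1w; have ww1' := neq _ _ (nesym w1w).
have a1w : (a1 == w) = false by apply: neqS; [|right].
have a1w1 : (a1 == w1) = false by apply: neqS; [|right].
have [wa1' w1a1'] : (w == a1) = false /\ (w1 == a1) = false.
  by rewrite ![_ == a1]eq_sym.
have a1A : (a1 \in A) = false by graph.
(* Sorting of the vertices into the five blocks of the construction, with Boolean equations ready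
   for rewriting. *)
have kind x : [\/ x = w, x = w1, x = a1
  | [/\ (x == w) = false, (x == w1) = false, (x == a1) = false
      & (x \in A /\ (x \in B) = false) \/ (x \in B /\ (x \in A) = false)]].
  case: (sep_cover sp x) => xP.
  - case: (eqVneq x w) => [|/eqP/(w1_uniq _ xP)]; first by constructor 1.
    by constructor 2.
  - constructor 4; split; [by apply: neqS; auto..|by apply: neq => ?; graph|].
    by left; split=> //; graph.
  - case: (eqVneq x a1) => [|/eqP/neq xa1]; first by constructor 3.
    constructor 4; split; [by apply: neqS; auto..|by []|].
    by right; split=> //; graph.
exists (B :\ a1), A, a0, u2, w, w1, a1; split.
- split.
  (* Both bounds by 3 come from degrees above [#|S| = 2]: all neighbours of [a1] lie in [B :\ a1],
     and those of [a0] in [A :\ a0] together with [w]. *)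
  + have := deg a1; rewrite S2 => /leq_trans; apply; apply: subset_leq_card.
    apply/subsetP => y; rewrite !inE => a1y; rewrite a1N 1?e_sym // andbT.
    by apply/eqP => ?; graph.
  + have := deg a0; rewrite S2 => /leq_trans; apply; rewrite (cardsD1 a0 A) a0A.
    rewrite -[X in X + _](cards1 w); apply: leq_trans (leq_card_setU _ _).
    apply: subset_leq_card.
    apply/subsetP => y; rewrite !inE => a0y.
    case: (sep_cover sp y) => yP; last by graph.
      case: (eqVneq y w) => //= yw; have := w1_uniq _ yP (elimN eqP yw).
      by move=> ?; graph.
    by rewrite yP andbT orbC; case: eqVneq => // ?; graph.
  + rewrite disjoint_subset; apply/subsetP => y; rewrite !inE => /andP[_ yB].
    by apply/negP => yA; graph.
- by split=> //; apply/eqP/nesym.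
- split; first by rewrite /= !inE ww1' wa1' w1a1'.
  rewrite disjoint_subset; apply/subsetP => y; rewrite !inE.
  by case: (kind y) => [->|->|->|[-> -> -> [][-> ->]]];
    rewrite ?wB' ?wA' ?w1B' ?w1A' ?a1A ?eqxx ?andbF.
- apply/setP => y; rewrite !inE.
  by case: (kind y) => [->|->|->|[_ _ -> [][-> _]]]; rewrite ?eqxx ?orbT.
have eA x y : x \in A -> y \in A -> e x y = (x != y).
  by move=> xA yA; case: eqVneq => [->|/eqP/cliqueA->//]; rewrite e_irr.
have eB x y : x \in B -> y \in B -> e x y = (x != y).
  by move=> xB yB; case: eqVneq => [->|/eqP/cliqueB->//]; rewrite e_irr.
have eAB x y : x \in A -> y \in B -> e x y = false by graph.
have ewA y : y \in A -> e w y = (y != u2).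
  by move=> yA; case: eqVneq => [->|/eqP/wA->].
have ew1A y : y \in A -> e w1 y = (y != a0).
  by move=> yA; case: eqVneq => [->|/eqP/w1A->//]; rewrite indep.
have eSB x z : x \in B -> z \in S -> e x z = (x != a1).
  move=> xB zS; case: eqVneq => [->|/eqP/B_S->//].
  by case: (eqVneq z w) => [->|/eqP/(w1_uniq _ zS)->]; [rewrite e_sym | rewrite indep].
move=> x y; rewrite /G2_33_edge /G2_33_arc /= !inE.
case: (kind x) => [->|->|->|[xw xw1 xa1 [][xA xB]]];
case: (kind y) => [->|->|->|[yw yw1 ya1 [][yA yB]]];
  rewrite ?(wA', wB', w1A', w1B', a1A, w1w', ww1', a1w, a1w1, wa1', w1a1')
    ?(xA, xB, xw, xw1, xa1) ?(yA, yB, yw, yw1, ya1) ?eqxx ?e_irr ?orbF //=.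
all: rewrite ?(andbF, andbT, orbT) // ?[y == x]eq_sym ?orbb.
all: first
  [ by rewrite ?ww1 // e_sym | by rewrite indep
  | by rewrite (ewA, ew1A) | by rewrite e_sym (ewA, ew1A)
  | by rewrite eA | by rewrite eB | by rewrite eB // ?xa1 // eq_sym ya1
  | by rewrite eAB | by rewrite e_sym eAB
  | by rewrite eSB ?xa1 ?ya1 | by rewrite e_sym eSB ?xa1 ?ya1 ].
Qed.

End Structure.

(** * Excluding a cut vertex *)

Section CutVertex.

Variables (S : {set T}) (c : T).
Hypotheses (cS : c \in S) (S_uniq : forall z, z \in S -> z = c).

Let no_indep (x y : T) : x \in S -> y \in S -> True. Proof. by []. Qed.

(** Any witness for a vertex of [A] and a vertex [b] of [B] missed by [c] is [c] itself. So either
    [b] is adjacent to all other vertices of [B], or [c] misses only [b] in [B]. In both cases [c]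
    and a suitable neighbour in [B] form a dominating edge. *)
Lemma cut_vertex_full_side A B : separation S A B ->
  (forall a, a \in A -> e c a) -> (exists2 b, b \in B & e c b) -> False.
Proof.
move=> sp cA [b' b'B cb']; have [a aA] := sep_A sp; have ca := cA a aA.
have dom_b b x : b \in B -> e c b = false -> x \in B -> x <> b ->
    e b x \/ forall v, v \in B -> v <> b -> e c v.
  move=> bB cb xB xb; have ab : a <> b by move=> ?; graph0 sp no_indep.
  case: (nonadjN ab) => [|dom|[z D]|[z D]]; first by graph0 sp no_indep.
  - by left; case: (dom x) => ?; graph0 sp no_indep.
  - right=> v vB vb; have Ez := S_uniq (dom_but_cut sp aA D); subst z.
    by case: D => _ _ /(_ v vb)[?|?|?|?]; graph0 sp no_indep.
  - have Ez := S_uniq (dom_but_cut (separationC sp) bB D); subst z.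
    by case: D => ? _ _; graph0 sp no_indep.
have full b'' : b'' \in B -> e c b'' ->
    (forall b, b \in B -> b <> b'' -> e c b = false -> e b'' b) -> False.
  move=> b''B cb'' all_b; apply: (edgeN cb'') => v.
  case: (sep_cover sp v) => vP.
  - by constructor 1; apply: S_uniq.
  - by constructor 3; apply: cA.
  - case: (eqVneq v b'') => [|/eqP vb'']; first by constructor 2.
    by case cv: (e c v); [constructor 3 | constructor 4; apply: all_b].
apply: (full b') => // b bB bb' cb; rewrite e_sym.
case: (dom_b b b' bB cb b'B (nesym bb')) => // only_b; exfalso.
have [b'' b''B bb''] := sep_nbrB sp bB.
have b''b : b'' <> b by move=> E; rewrite E e_irr in bb''.
apply: (full b'' b''B (only_b _ b''B b''b)) => v vB _ cv.
case: (eqVneq v b) => [->|/eqP vb]; first by rewrite e_sym.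
by rewrite only_b in cv.
Qed.

(** If [c] missed [a] in [A] and [b] in [B], this pair would violate criticality: it does not
    dominate [c], and the only possible witness [c] is adjacent to neither. So [c] is joined to a
    whole side. *)
Lemma no_cut_vertex A B : separation S A B ->
  (exists2 a, a \in A & e c a) -> (exists2 b, b \in B & e c b) -> False.
Proof.
move=> sp cA cB.
have [/forall_inP allA|] := boolP [forall a in A, e c a].
  exact: cut_vertex_full_side sp allA cB.
case/forall_inPn=> a aA /negbTE ca.
have [/forall_inP allB|] := boolP [forall b in B, e c b].
  exact: cut_vertex_full_side (separationC sp) allB cA.
case/forall_inPn=> b bB /negbTE cb.
have ab : a <> b by move=> ?; graph0 sp no_indep.
case: (nonadjN ab) => [|dom|[z D]|[z D]]; first by graph0 sp no_indep.
- by case: (dom c) => ?; graph0 sp no_indep.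
- have Ez := S_uniq (dom_but_cut sp aA D); subst z.
  by case: D => ? _ _; graph0 sp no_indep.
- have Ez := S_uniq (dom_but_cut (separationC sp) bB D); subst z.
  by case: D => ? _ _; graph0 sp no_indep.
Qed.

End CutVertex.

(** * Connectedness and vertex cuts *)

Lemma connected_graph_crossing (D : {set T}) x y : connected_graph e ->
  x \in D -> y \notin D -> exists p q, [/\ p \in D, q \notin D & e p q].
Proof.
move=> /forall_inP/(_ x (in_setT x))/forall_inP/(_ y (in_setT y)) con xD yD.
have [/existsP[p /existsP[q /and3P[]]]|noedge] :=
  boolP [exists p, exists q, [&& p \in D, q \notin D & e p q]].
  by exists p, q.
case/negP: yD; rewrite -(closed_connect _ con) // => p q /and3P[_ _ epq].
have cross u v : e u v -> u \in D -> v \in D.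
  move=> euv uD; apply: contraR noedge => vD.
  by apply/existsP; exists u; apply/existsP; exists v; rewrite uD vD.
by apply/idP/idP; apply: cross; rewrite // e_sym.
Qed.

(* The minimum degree bound leaves every vertex outside the cut a neighbour on
   its own side. *)
Lemma vertex_cut_separation S : vertex_cut e S ->
  (forall x, #|S| < degree e x) -> exists A B, separation S A B.
Proof.
move=> cut deg; set r := connect (induced e (~: S)).
have r_sym : connect_sym (induced e (~: S)).
  by apply: sym_connect_sym => x y; rewrite /induced /= andbCA e_sym.
have [a [b [aS bS ab]]] : exists a b, [/\ a \notin S, b \notin S & ~~ r a b].
  case/forall_inPn: cut => a; rewrite inE => aS /forall_inPn[b].
  by rewrite inE => bS ab; exists a, b.
have r_step x y : x \notin S -> y \notin S -> e x y -> r a x = r a y.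
  move=> xS yS exy; apply: same_connect_r => //; apply: connect1.
  by rewrite /induced /= !inE xS yS.
have nbr x : exists2 y, y \notin S & e x y.
  have [/exists_inP[y yS xy]|noy] := boolP [exists y in ~: S, e x y].
    by exists y => //; rewrite inE in yS.
  have := deg x; rewrite ltnNge => /negP[]; apply/subset_leq_card/subsetP => y.
  rewrite inE => xy; apply: contraR noy => yS.
  by apply/exists_inP; exists y; rewrite // inE.
exists [set x | (x \notin S) && r a x], [set x | (x \notin S) && ~~ r a x].
split=> [x|x xS|x xS|x|x y|x|x||]; rewrite ?inE.
- case: (x \in S); first by constructor 1.
  by case: (r a x); [constructor 2 | constructor 3].
- by rewrite xS.
- by rewrite xS.
- by case/andP=> -> ->.
- case/andP=> xS ax /andP[yS /negP ay]; apply/negP => xy; apply: ay.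
  by rewrite -(r_step x).
- case/andP=> xS ax; have [y yS xy] := nbr x.
  by exists y; rewrite // inE yS -(r_step x).
- case/andP=> xS ax; have [y yS xy] := nbr x.
  by exists y; rewrite // inE yS -(r_step x).
- by exists a; rewrite inE aS /r connect0.
- by exists b; rewrite inE bS.
Qed.

(** Connectedness gives each side an edge into [S], so a one-element [S] would be an excluded cut
    vertex. This bound yields the three elements of [I] needed above. *)
Lemma separation_cut_ge2 S A B :
  connected_graph e -> separation S A B -> 2 <= #|S|.
Proof.
move=> con sp.
have crossing A' B' : separation S A' B' -> exists p q, [/\ p \in A', q \in S & e p q].
  move=> sp'; have [a aA] := sep_A sp'; have [b bB] := sep_B sp'.
  have bA : b \notin A' by apply/negP => /(sep_AB sp'); rewrite bB.
  have [p [q [pA qA pq]]] := connected_graph_crossing con aA bA.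
  exists p, q; split=> //; case: (sep_cover sp' q) => // qP.
    by rewrite qP in qA.
  by rewrite (sep_edge sp' pA qP) in pq.
have [p [c [pA cS pc]]] := crossing _ _ sp.
have [q [c' [qB c'S qc']]] := crossing _ _ (separationC sp).
rewrite ltnNge; apply/negP => S1; have S_uniq z : z \in S -> z = c.
  by move=> zS; apply: (card_le1_eqP S1).
apply: (no_cut_vertex cS S_uniq sp); first by exists p; rewrite // e_sym.
by exists q; rewrite // e_sym -(S_uniq c').
Qed.

End Critical.

Theorem theorem4p1 (T : finType) (e : rel T)
  (e_sym : symmetric e) (e_irr : irreflexive e)
  (e_conn : connected_graph e)
  (e_crit : gamma_c_critical3 e)
  (delta_ge2 : 2 <= min_degree e)
  (kappa_le : kappa e <= min_degree e - 1) :
  alpha e <= kappa e \/ in_G2_33 e.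
Proof.
have deg x : min_degree e <= degree e x by apply: bigminn_le.
have has_nbr x : exists y, e x y.
  have /card_gt0P[y] : 0 < degree e x by apply: leq_trans (deg x); lia.
  by rewrite inE; exists y.
have edgeN := edge_not_dom e_sym e_crit.
have nonadjN := nonadjacent_dom e_sym e_irr e_crit has_nbr.
have [S cutS Skappa] : exists2 S, vertex_cut e S & kappa e = #|S|.
  case: (bigminn_eqP #|T|.-1 (vertex_cut e) (fun S : {set T} => #|S|)) => //.
  (* If [kappa] took its default [#|T|.-1], the minimum degree would be [#|T|], but a vertex is not
     its own neighbour. *)
  rewrite -/(kappa e) => kT.
  have : min_degree e <= #|T| by apply: bigminn_le_idx.
  move: kappa_le; rewrite kT => le_T leT.
  have minT : min_degree e = #|T| by lia.
  have /card_gt0P[x _] : 0 < #|T| by lia.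
  have := max_card (mem (x |: [set y | e x y])).
  by rewrite cardsU1 inE e_irr -/(degree e x); have := deg x; lia.
have degS x : #|S| < degree e x by have := deg x; move: kappa_le; rewrite Skappa; lia.
have [|gt_alpha] := leqP (alpha e) (kappa e); first by left.
right; have [A [B sp]] := vertex_cut_separation e_sym cutS degS.
have S_ge2 := separation_cut_ge2 e_sym e_irr edgeN nonadjN e_conn sp.
have [I indI cardI] : exists2 I, independent e I & #|I| = #|S|.+1.
  have [J indJ Jalpha] : exists2 J, independent e J & alpha e = #|J|.
    have ind0 : independent e set0 by apply/forall_inP => x; rewrite inE.
    by rewrite /alpha (bigop.bigmax_eq_arg _ ind0); case: arg_maxnP => // J ? _; exists J.
  have leJ : #|S|.+1 <= #|J| by rewrite -Skappa -Jalpha.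
  (* A maximum independent set is cut down to exactly [#|S|.+1] elements, as the counting
     requires. *)
  exists [set x in take #|S|.+1 (enum J)].
    apply/forall_inP => x; rewrite inE => /mem_take; rewrite mem_enum => xJ.
    apply/forall_inP => y; rewrite inE => /mem_take; rewrite mem_enum.
    by have /forall_inP := forall_inP indJ x xJ; apply.
  by rewrite cardsE (card_uniqP (take_uniq _ (enum_uniq _))) size_takel -?cardE.
have indep x y : x \in I -> y \in I -> e x y = false.
  by move=> xI yI; apply/negbTE; have/forall_inP->// := forall_inP indI x xI.
have I_ge3 : 3 <= #|I| by rewrite cardI.
have [a0 [f [/setDP[a0I a0S] fP f_onto]]] :=
  indep_matching e_sym e_irr nonadjN indep I_ge3 sp cardI.
have fP' a : a \in I -> (a \in S) = false -> a <> a0 ->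
    [/\ f a \in S, (f a \in I) = false & dom_but e a0 (f a) a].
  move=> aI aS aa0; have [|/setDP[faS /negbTE faI] D] := fP a _ aa0; last by [].
  by rewrite inE aS.
have f_onto' z : z \in S -> (z \in I) = false ->
    exists a, [/\ a \in I, (a \in S) = false, a <> a0 & z = f a].
  move=> zS zI; have [|a [/setDP[aI /negbTE aS] aa0 Ez]] := f_onto z.
    by rewrite inE zI.
  by exists a.
(* The side containing [a0] takes the role of [A]. *)
case: (sep_cover sp a0) => [|a0A|a0B]; first by rewrite (negPf a0S).
  exact: (indep_in_G2_33 e_sym e_irr edgeN nonadjN indep I_ge3 cardI
    sp a0A a0I fP' f_onto' degS).
exact: (indep_in_G2_33 e_sym e_irr edgeN nonadjN indep I_ge3 cardI
  (separationC e_sym sp) a0B a0I fP' f_onto' degS).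
Qed.
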